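(* Every ill-founded countable model of set theory $\langle M,\in^M\rangle$ is universal for all countable acyclic binary relations: for every countable set $G$ with an acyclic binary relation $\rightharpoonup$ on it, $\langle G,\rightharpoonup\rangle$ is isomorphic to a submodel of $\langle M,\in^M\rangle$.
   Context: A model of set theory is a first-order structure $\langle M,\in^M\rangle$ satisfying at least the Kripke–Platek axioms KP. It is ill-founded if the relation $\in^M$ is not well-founded (as judged externally). A binary relation $\rightharpoonup$ on $G$ is acyclic if there is no finite directed path (of length at least one) from a point of $G$ to itself. A submodel is an arbitrary subset with the restricted relation (an induced substructure). *)

(* Defs.v *)
From Stdlib Require Export Relation_Operators.
From mathcomp Require Export all_boot.
From mathcomp Require Export boolp classical_sets functions cardinality.

Set Implicit Arguments.
Unset Strict Implicit.
Unset Printing Implicit Defensive.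

(* First-order formulas in the language {=, \in}, in de Bruijn style: variable
   0 is bound by the innermost enclosing quantifier, and variables beyond the
   enclosing quantifiers are free. *)
Inductive formula : Type :=
| Mem (i j : nat)
| Eq (i j : nat)
| Bot
| Imp (p q : formula)
| And (p q : formula)
| Or (p q : formula)
| All (p : formula)
| Ex (p : formula).

(* In a bounded quantifier the bound is a variable j of the context outside the
   quantifier (hence j.+1 under it), so it differs from the bound variable. *)
Inductive Delta0 : formula -> Prop :=
| Delta0_Mem i j : Delta0 (Mem i j)
| Delta0_Eq i j : Delta0 (Eq i j)
| Delta0_Bot : Delta0 Bot
| Delta0_Imp p q : Delta0 p -> Delta0 q -> Delta0 (Imp p q)
| Delta0_And p q : Delta0 p -> Delta0 q -> Delta0 (And p q)
| Delta0_Or p q : Delta0 p -> Delta0 q -> Delta0 (Or p q)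
| Delta0_All j p : Delta0 p -> Delta0 (All (Imp (Mem 0 j.+1) p))
| Delta0_Ex j p : Delta0 p -> Delta0 (Ex (And (Mem 0 j.+1) p)).

Definition scons (M : Type) (a : M) (e : nat -> M) : nat -> M :=
  fun n => if n is m.+1 then e m else a.

(* Tarskian satisfaction in the structure (M, E), where E x y reads "x is an
   element of y" and the equality symbol denotes true equality. *)
Fixpoint sat (M : Type) (E : M -> M -> Prop) (e : nat -> M) (p : formula) :
    Prop :=
  match p with
  | Mem i j => E (e i) (e j)
  | Eq i j => e i = e j
  | Bot => False
  | Imp p q => sat E e p -> sat E e q
  | And p q => sat E e p /\ sat E e q
  | Or p q => sat E e p \/ sat E e q
  | All p => forall a, sat E (scons a e) p
  | Ex p => exists a, sat E (scons a e) p
  end.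

(* (M, E) is a model of Kripke-Platek set theory, without the axiom of infinity
   and with foundation (set induction) for all formulas.  The environment e
   supplies the parameters of the schemes; it may assign the set a of
   separation and collection to a parameter, but not the set b asserted to
   exist, which is quantified after e. *)
Record KP (M : Type) (E : M -> M -> Prop) : Prop := {
  KP_extensionality :
    forall a b, (forall x, E x a <-> E x b) -> a = b;
  KP_empty :
    exists a, forall x, ~ E x a;
  KP_pairing :
    forall a b, exists c, forall x, E x c <-> x = a \/ x = b;
  KP_union :
    forall a, exists u, forall x, E x u <-> exists y, E x y /\ E y a;
  KP_foundation :
    forall (p : formula) (e : nat -> M),
      (forall x, (forall y, E y x -> sat E (scons y e) p) ->
                 sat E (scons x e) p) ->
      forall x, sat E (scons x e) p;
  KP_Delta0_separation :
    forall p : formula, Delta0 p -> forall (e : nat -> M) (a : M),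
      exists b, forall x, E x b <-> E x a /\ sat E (scons x e) p;
  KP_Delta0_collection :
    forall p : formula, Delta0 p -> forall (e : nat -> M) (a : M),
      (forall x, E x a -> exists y, sat E (scons y (scons x e)) p) ->
      exists b, forall x, E x a ->
        exists y, E y b /\ sat E (scons y (scons x e)) p }.

Definition ill_founded (M : Type) (E : M -> M -> Prop) : Prop :=
  ~ well_founded E.

(* [clos_trans] relates two points iff a directed path of length at least one
   leads from the first to the second. *)
Definition acyclic (G : Type) (R : G -> G -> Prop) : Prop :=
  forall x, ~ clos_trans G R x x.

Definition submodel (M : Type) (E : M -> M -> Prop) (N : set M) :
    N -> N -> Prop :=
  fun x y => E (val x) (val y).

Definition isomorphic (A B : Type) (R : A -> A -> Prop) (S : B -> B -> Prop) :
    Prop :=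
  exists f : A -> B, bijective f /\ forall x y, R x y <-> S (f x) (f y).

(* Main.v *)
Require Import Defs.
From Stdlib Require List.

(* Enumerate G and place its points one at a time on stages W of M, ordered
   compatibly with R.  A point on stage W gets a hereditarily finite name s and
   goes to the set node(W, s) of those y in W whose name is adjacent to s,
   together with s itself, from which the name can be read off.  For a in W,
   whether a belongs to node(W, s) thus depends on the two names only; names are
   adjacent when one belongs to the other, as in the Rado graph, so that a new
   name can realize any adjacency pattern to finitely many old ones.

   A new stage has to fit between any two old ones, and these must contain the
   new node.  By foundation, every x and every set U admit a set V such that
   the interval (U, V) has rank x: for every y in x it splits into intervals
   (U, W) and (W', V') of rank y with V' included in V, where W' contains all
   nodes on W.  If x is in the ill-founded part of M, some y in x is too, so
   intervals of ill-founded rank split forever. *)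

Set Implicit Arguments.
Unset Strict Implicit.
Unset Printing Implicit Defensive.

(** * Lists whose entries are pairwise related in order *)

Lemma in_cat (T : Type) (x : T) l1 l2 :
  List.In x (l1 ++ l2) <-> List.In x l1 \/ List.In x l2.
Proof. exact: List.in_app_iff. Qed.

Lemma in_insert (T : Type) (x p : T) l1 l2 :
  List.In x (l1 ++ p :: l2) <-> x = p \/ List.In x (l1 ++ l2).
Proof. by rewrite !in_cat /=; intuition. Qed.

Fixpoint all_pairs (T : Type) (P : T -> T -> Prop) (l : seq T) : Prop :=
  if l is p :: l' then (forall q, List.In q l' -> P p q) /\ all_pairs P l'
  else True.

Lemma all_pairs_in (T : Type) (P : T -> T -> Prop) l p q :
  all_pairs P l -> List.In p l -> List.In q l -> p = q \/ P p q \/ P q p.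
Proof.
by elim: l => // r l IH [Hr Hl] [<-|pl] [<-|ql]; auto.
Qed.

Lemma all_pairs_insert (T : Type) (P : T -> T -> Prop) p l1 l2 :
  all_pairs P (l1 ++ l2) ->
  (forall q, List.In q l1 -> P q p) -> (forall q, List.In q l2 -> P p q) ->
  all_pairs P (l1 ++ p :: l2).
Proof.
elim: l1 => [|q l1 IH] //= [Hq Hl] Hl1 Hl2; split; last first.
  by apply: IH => // r ?; apply: Hl1; right.
by move=> r /in_insert[->|/Hq//]; apply: Hl1; left.
Qed.

(** * Definability in the structure *)

Section KripkePlatek.
Variables (M : Type) (E : M -> M -> Prop).

(** Predicates on environments stand in for formulas, so that the [delta0] tactic can assemble them
    and no de Bruijn formula is written by hand. *)
Definition definable (P : (nat -> M) -> Prop) : Prop :=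
  exists p, forall e, sat E e p <-> P e.

Definition definable0 (P : (nat -> M) -> Prop) : Prop :=
  exists2 p, Delta0 p & forall e, sat E e p <-> P e.

Lemma definable_delta0 P : definable0 P -> definable P.
Proof. by move=> [p _ sat_p]; exists p. Qed.

Lemma definable_all (Q : M -> (nat -> M) -> Prop) :
  definable (fun e => Q (e 0) (fun n => e n.+1)) ->
  definable (fun e => forall a, Q a e).
Proof.
by move=> [p sat_p]; exists (All p) => e /=; split=> H a;
  exact/(sat_p (scons a e))/H.
Qed.

Lemma definable_ex (Q : M -> (nat -> M) -> Prop) :
  definable (fun e => Q (e 0) (fun n => e n.+1)) ->
  definable (fun e => exists a, Q a e).
Proof.
by move=> [p sat_p]; exists (Ex p) => e /=;
  split=> -[a /(sat_p (scons a e))]; exists a.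
Qed.

Lemma delta0_ext P Q :
  definable0 P -> (forall e, P e <-> Q e) -> definable0 Q.
Proof. by move=> [p ? sat_p] PQ; exists p => // e; rewrite sat_p. Qed.

Lemma delta0_mem i j : definable0 (fun e => E (e i) (e j)).
Proof. by exists (Mem i j) => //; constructor. Qed.

Lemma delta0_eq i j : definable0 (fun e => e i = e j).
Proof. by exists (Eq i j) => //; constructor. Qed.

Lemma delta0_bot : definable0 (fun=> False).
Proof. by exists Bot => //; constructor. Qed.

Lemma delta0_imp P Q :
  definable0 P -> definable0 Q -> definable0 (fun e => P e -> Q e).
Proof.
move=> [p D0p sat_p] [q D0q sat_q]; exists (Imp p q); first by constructor.
by move=> e /=; rewrite sat_p sat_q.
Qed.

Lemma delta0_and P Q :
  definable0 P -> definable0 Q -> definable0 (fun e => P e /\ Q e).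
Proof.
move=> [p D0p sat_p] [q D0q sat_q]; exists (And p q); first by constructor.
by move=> e /=; rewrite sat_p sat_q.
Qed.

Lemma delta0_or P Q :
  definable0 P -> definable0 Q -> definable0 (fun e => P e \/ Q e).
Proof.
move=> [p D0p sat_p] [q D0q sat_q]; exists (Or p q); first by constructor.
by move=> e /=; rewrite sat_p sat_q.
Qed.

Lemma delta0_all j (Q : M -> (nat -> M) -> Prop) :
  definable0 (fun e => Q (e 0) (fun n => e n.+1)) ->
  definable0 (fun e => forall a, E a (e j) -> Q a e).
Proof.
move=> [p D0p sat_p]; exists (All (Imp (Mem 0 j.+1) p)); first by constructor.
by move=> e /=; split=> H a aj; exact/(sat_p (scons a e))/H.
Qed.

Lemma delta0_ex j (Q : M -> (nat -> M) -> Prop) :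
  definable0 (fun e => Q (e 0) (fun n => e n.+1)) ->
  definable0 (fun e => exists a, E a (e j) /\ Q a e).
Proof.
move=> [p D0p sat_p]; exists (Ex (And (Mem 0 j.+1) p)); first by constructor.
by move=> e /=; split=> -[a [aj /(sat_p (scons a e))]]; exists a.
Qed.

(** * Set-theoretic vocabulary and its bounded forms *)

Definition sub (a b : M) : Prop := forall x, E x a -> E x b.

Definition pair (p a b : M) : Prop :=
  E a p /\ E b p /\ forall x, E x p -> x = a \/ x = b.

Definition opair (z a b : M) : Prop :=
  exists u, E u z /\ exists v, E v z /\
    (pair z u v /\ pair u a a /\ pair v a b).

Definition empty (a : M) : Prop := forall x, E x a -> False.

Definition has_empty (a : M) : Prop := exists o, E o a /\ empty o.

Definition adjoin (c a b : M) : Prop :=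
  sub a c /\ E b c /\ forall x, E x c -> E x a \/ x = b.

Definition adj (s t : M) : Prop := E s t \/ E t s \/ s = t.

(* The name of [y] is its only element that contains the empty set; [y] itself
   must not contain the empty set, so that [y] cannot be mistaken for a name. *)
Definition linked (y s : M) : Prop :=
  (has_empty y -> False) /\ exists u, E u y /\ (has_empty u /\ adj u s).

Definition node (a W s : M) : Prop :=
  E s a /\ (forall y, E y W -> linked y s -> E y a) /\
  forall y, E y a -> E y W /\ linked y s \/ y = s.

(** Closure under [adjoin] serves to capture the hereditarily finite sets: each of them is reached
    after finitely many steps. *)
Definition step (W W' : M) : Prop :=
  sub W W' /\
  (forall s, E s W -> exists a, E a W' /\ node a W s) /\
  (forall a, E a W -> forall b, E b W -> exists c, E c W' /\ adjoin c a b).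

(* The triple (x, U, V) is coded by the ordered pair of x and {U, V}, the
   inclusion telling U from V. *)
Definition interval (c x U V : M) : Prop :=
  exists z p, E z c /\ opair z x p /\ pair p U V /\ sub U V.

Definition splits (c y U V : M) : Prop :=
  exists W W' V',
    interval c y U W /\ step W W' /\ interval c y W' V' /\ sub V' V.

(* The rank of an interval is recorded in a set [c] of triples because the
   recursion along x is not available as a formula, whereas the existence of
   [c] is proved by induction using only Delta0 collection. *)
Definition certificate (c : M) : Prop :=
  forall x U V, interval c x U V -> forall y, E y x -> splits c y U V.

Ltac delta0 :=
  unfold step, node, linked, adj, adjoin, has_empty, empty, opair, pair, sub;
  repeat (cbv beta; first
    [ apply: delta0_mem | apply: delta0_eq | apply: delta0_bot
    | apply: delta0_all | apply: delta0_ex | apply: delta0_and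
    | apply: delta0_or | apply: delta0_imp ]).

Lemma pair_inj p a b a' b' :
  pair p a b -> pair p a' b' -> a = a' /\ b = b' \/ a = b' /\ b = a'.
Proof.
move=> [ap [bp pab]] [a'p [b'p pab']].
by case: (pab _ a'p) (pab _ b'p) (pab' _ ap) (pab' _ bp) =>
  [->|->] [->|->] [?|?] [?|?]; auto.
Qed.

Lemma opair_inj z a b a' b' : opair z a b -> opair z a' b' -> a = a' /\ b = b'.
Proof.
move=> [u [_ [v [_ [zp [up vp]]]]]] [u' [_ [v' [_ [zp' [up' vp']]]]]].
case: (pair_inj zp zp') => -[eu ev]; subst.
  have ea : a = a' by case: (pair_inj up up') => -[].
  by subst; split=> //; case: (pair_inj vp vp') => -[] *; congruence.
by case: (pair_inj vp up') (pair_inj up vp') => -[] ? ? [] [] ? ?;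
  split; congruence.
Qed.

Lemma opair_mem_r z a b : opair z a b -> exists2 u, E u z & E b u.
Proof. by move=> [_ [_ [v [vz [_ [_ [_ [bv _]]]]]]]]; exists v. Qed.

Lemma opair_mem_l z a b : opair z a b -> exists2 u, E u z & E a u.
Proof. by move=> [u [uz [_ [_ [_ [[au _] _]]]]]]; exists u. Qed.

(** The quantifier over [p] is bounded by going through the element [u] of the ordered pair [z] that
    contains [p]. *)
Lemma interval_delta0 i j k l :
  definable0 (fun e => interval (e i) (e j) (e k) (e l)).
Proof.
apply: (@delta0_ext (fun e =>
  exists z, E z (e i) /\ exists u, E u z /\ exists p, E p u /\
    (opair z (e j) p /\ pair p (e k) (e l) /\ sub (e k) (e l)))).
  by delta0.
move=> e; split=> [[z [zc [u [uz [p [pu ?]]]]]]|[z [p [zc [zp ?]]]]].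
  by exists z, p.
have [u uz pu] := opair_mem_r zp.
by exists z; split=> //; exists u; split=> //; exists p.
Qed.

Lemma splits_delta0 i j k l :
  definable0 (fun e => splits (e i) (e j) (e k) (e l)).
Proof.
apply: (@delta0_ext (fun e =>
  exists z1, E z1 (e i) /\ exists u1, E u1 z1 /\ exists p1, E p1 u1 /\
  exists z2, E z2 (e i) /\ exists u2, E u2 z2 /\ exists p2, E p2 u2 /\
  exists W, E W p1 /\ exists W', E W' p2 /\ exists V', E V' p2 /\
    ((opair z1 (e j) p1 /\ pair p1 (e k) W /\ sub (e k) W) /\ step W W' /\
     (opair z2 (e j) p2 /\ pair p2 W' V' /\ sub W' V') /\ sub V' (e l)))).
  by delta0.
move=> e; split.
  move=> [z1 [? [u1 [? [p1 [? [z2 [? [u2 [? [p2 [? H]]]]]]]]]]]].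
  case: H => W [? [W' [? [V' [? [? [? [? ?]]]]]]]].
  exists W, W', V'; split; first by exists z1, p1.
  by split=> //; split=> //; exists z2, p2.
move=> [W [W' [V' [[z1 [p1 [z1c [zp1 [pp1 UW]]]]] [st
  [[z2 [p2 [z2c [zp2 [pp2 WV]]]]] V'V]]]]]].
have [u1 u1z pu1] := opair_mem_r zp1; have [u2 u2z pu2] := opair_mem_r zp2.
have [_ [Wp _]] := pp1; have [W'p [V'p _]] := pp2.
exists z1; split=> //; exists u1; split=> //; exists p1; split=> //.
exists z2; split=> //; exists u2; split=> //; exists p2; split=> //.
by exists W; split=> //; exists W'; split=> //; exists V'.
Qed.

Lemma certificate_delta0 i : definable0 (fun e => certificate (e i)).
Proof.
apply: (@delta0_ext (fun e =>
  forall z, E z (e i) -> forall u, E u z -> forall p, E p u ->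
  forall v, E v z -> forall x, E x v -> forall U, E U p -> forall V, E V p ->
    opair z x p -> pair p U V -> sub U V ->
    forall y, E y x -> splits (e i) y U V)).
  by delta0; apply: splits_delta0.
move=> e; split=> [H x U V [z [p [zc [zp [pp UV]]]]]|H].
  have [u uz pu] := opair_mem_r zp; have [v vz xv] := opair_mem_l zp.
  have [Up [Vp _]] := pp.
  exact: (H z zc u uz p pu v vz x xv U Up V Vp).
move=> z zc u uz p pu v vz x xv U Up V Vp *; apply: (H x U V) => //.
by exists z, p.
Qed.

(** * Elementary consequences of KP *)

Section Model.
Hypothesis K : KP E.

Lemma set_ind (P : M -> Prop) :
  definable (fun e => P (e 0)) ->
  (forall x, (forall y, E y x -> P y) -> P x) -> forall x, P x.
Proof.
move=> [p sat_p] IH x.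
apply/(sat_p (scons x (fun=> x)))/(KP_foundation K) => y yP.
by apply/(sat_p (scons y (fun=> x)))/IH => z /yP /(sat_p (scons z (fun=> x))).
Qed.

Lemma separation (P : M -> M -> Prop) (q a : M) :
  definable0 (fun e => P (e 0) (e 1)) ->
  exists b, forall x, E x b <-> E x a /\ P x q.
Proof.
move=> [p D0p sat_p].
have [b Hb] := KP_Delta0_separation K D0p (fun=> q) a.
by exists b => x; rewrite Hb (sat_p (scons x (fun=> q))).
Qed.

Lemma collection (P : M -> M -> M -> Prop) (q a : M) :
  definable0 (fun e => P (e 0) (e 1) (e 2)) ->
  (forall x, E x a -> exists y, P y x q) ->
  exists b, forall x, E x a -> exists y, E y b /\ P y x q.
Proof.
move=> [p D0p sat_p] H.
have [|b Hb] := KP_Delta0_collection K D0p (e := fun=> q) (a := a).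
  by move=> x /H [y /(sat_p (scons y (scons x (fun=> q)))) ?]; exists y.
exists b => x /Hb [y [yb /(sat_p (scons y (scons x (fun=> q)))) ?]].
by exists y.
Qed.

Lemma mem_irr x : ~ E x x.
Proof.
move: x; apply: set_ind; last by move=> x IH xx; exact: (IH x xx xx).
by apply: definable_delta0; delta0.
Qed.

Lemma mem_asym x y : E x y -> ~ E y x.
Proof.
move: x y; apply: (@set_ind (fun x => forall y, E x y -> ~ E y x)).
  by apply: definable_all; apply: definable_delta0; delta0.
by move=> x IH y xy yx; exact: (IH y yx x yx xy).
Qed.

Lemma mem_acyc3 x y z : E x y -> E y z -> ~ E z x.
Proof.
move: x y z.
apply: (@set_ind (fun x => forall y z, E x y -> E y z -> ~ E z x)).
  by do 2 apply: definable_all; apply: definable_delta0; delta0.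
by move=> x IH y z xy yz zx; exact: (IH z zx x y zx xy yz).
Qed.

Lemma pair_ex a b : exists p, pair p a b.
Proof.
have [p Hp] := KP_pairing K a b; exists p.
by split; [|split]; [apply/Hp; left|apply/Hp; right|move=> x /Hp].
Qed.

Lemma opair_ex a b : exists z, opair z a b.
Proof.
have [u Hu] := pair_ex a a; have [v Hv] := pair_ex a b.
have [z Hz] := pair_ex u v; have [uz [vz _]] := Hz.
by exists z, u; split=> //; exists v.
Qed.

Lemma union2_ex a b : exists c, forall x, E x c <-> E x a \/ E x b.
Proof.
have [p [ap [bp Hp]]] := pair_ex a b; have [c Hc] := KP_union K p.
exists c => x; rewrite Hc; split.
  by move=> [y [xy /Hp[]]] <-; auto.
by case=> ?; [exists a|exists b].
Qed.

Lemma adjoin_ex a b : exists c, adjoin c a b.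
Proof.
have [p [bp [_ Hp]]] := pair_ex b b; have [c Hc] := union2_ex a p.
exists c; split; first by move=> x ?; apply/Hc; left.
by split=> [|x /Hc[?|/Hp[]]]; auto; apply/Hc; right.
Qed.

Lemma node_ex W s : exists a, node a W s.
Proof.
have [|b Hb] := @separation linked s W; first by delta0.
have [a [ba [sa Ha]]] := adjoin_ex b s.
exists a; split=> //; split=> [y yW ys|y /Ha[/Hb|]]; auto.
by apply/ba/Hb.
Qed.

Lemma step_ex W : exists W', step W W'.
Proof.
have [|s _|N HN] := @collection (fun a s W => node a W s) W W; first by delta0.
  exact: node_ex.
(* Collection runs twice: over [b] for fixed [a], giving [d], and over [a], gathering these [d] in
   [D]. *)
pose closed d a W := forall b, E b W -> exists c, E c d /\ adjoin c a b.
have [|a _|D HD] := @collection closed W W; first by rewrite /closed; delta0.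
  have [|b _|d Hd] := @collection (fun c b a => adjoin c a b) a W.
  - by delta0.
  - exact: adjoin_ex.
  - by exists d.
have [A HA] := KP_union K D.
have [B HB] := union2_ex N A; have [W' HW'] := union2_ex W B.
exists W'; split; first by move=> x ?; apply/HW'; left.
split=> [s /HN[a [aN ?]]|a /HD[d [dD Hd]] b /Hd[c [cd ?]]].
  by exists a; split=> //; apply/HW'; right; apply/HB; left.
exists c; split=> //; apply/HW'; right; apply/HB; right; apply/HA.
by exists d.
Qed.

(** * Certified intervals *)

Lemma splits_mono c c' y U V V' :
  sub c c' -> sub V V' -> splits c y U V -> splits c' y U V'.
Proof.
move=> cc' VV' [W [W' [V0 [[z1 [p1 [? ?]]] [? [[z2 [p2 [? ?]]] ?]]]]]].
exists W, W', V0; split; first by exists z1, p1; split=> //; apply: cc'.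
split=> //; split; first by exists z2, p2; split=> //; apply: cc'.
by move=> x; auto.
Qed.

Lemma interval_mono c c' x U V :
  sub c c' -> interval c x U V -> interval c' x U V.
Proof. by move=> cc' [z [p [/cc' ? ?]]]; exists z, p. Qed.

Lemma certificate_union b c :
  (forall c', E c' b -> certificate c') ->
  (forall z, E z c <-> exists c', E z c' /\ E c' b) -> certificate c.
Proof.
move=> cert Hc x U V [z [p [/Hc[c' [zc' c'b]] H]]] y yx.
apply: (@splits_mono c' _ _ _ V) => //.
  by move=> w ?; apply/Hc; exists c'.
by apply: (cert c' c'b x) => //; exists z, p.
Qed.

(** For each [y] in [x], two intervals given by induction, with a step between them, form a
    splitting. Gluing their certificates and adding the triple (x, U, V), with [V] above all right
    ends, certifies [x]. *)
Lemma interval_ex x U : exists V c, certificate c /\ interval c x U V.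
Proof.
move: x U; apply: (@set_ind (fun x => forall U, exists V c, _)).
  apply: definable_all; do 2 apply: definable_ex.
  apply: definable_delta0; apply: delta0_and; first exact: certificate_delta0.
  exact: interval_delta0.
move=> x IH U.
(* [d] holds both the certificate and the right end, so that one collection gathers both. *)
pose half d y U := exists c, E c d /\ exists V, E V d /\
  (certificate c /\ splits c y U V).
have [||b Hb] := @collection half U x.
- rewrite /half; delta0; [exact: certificate_delta0|exact: splits_delta0].
- move=> y yx; have [W [c1 [cert1 int1]]] := IH y yx U.
  have [W' st] := step_ex W; have [V [c2 [cert2 int2]]] := IH y yx W'.
  have [q [c1q [c2q Hq]]] := pair_ex c1 c2; have [c Hc] := KP_union K q.
  have [d [cd [Vd _]]] := pair_ex c V.
  exists d, c; split=> //; exists V; split=> //; split.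
    by apply: (certificate_union _ Hc) => c' /Hq[]->.
  exists W, W', V; split.
    by apply: interval_mono int1 => z ?; apply/Hc; exists c1.
  split=> //; split=> //.
  by apply: interval_mono int2 => z ?; apply/Hc; exists c2.
have [B HB] := KP_union K b.
have [|C HC] := @separation (fun c _ => certificate c) U B.
  exact: certificate_delta0.
have [c0 Hc0] := KP_union K C; have [V0 HV0] := KP_union K B.
have [V HV] := union2_ex U V0.
have UV : sub U V by move=> w ?; apply/HV; left.
have [p pp] := pair_ex U V; have [z zp] := opair_ex x p.
have [c [c0c [zc Hc]]] := adjoin_ex c0 z.
exists V, c; split; last by exists z, p.
move=> x' U' V' [z' [p' [/Hc[z'c0|->] [zp' [pp' UV']]]]] y yx.
  apply: (splits_mono c0c (V := V')) => //.
  apply: (@certificate_union C _ _ Hc0 x') => // [c' /HC[]//|].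
  by exists z', p'.
have [ex ep] := opair_inj zp' zp; subst x' p'.
have [eU eV] : U' = U /\ V' = V.
  (* If the unordered pair is read in reverse, the inclusions in both directions force [U = V]. *)
  case: (pair_inj pp' pp) => // -[? ?]; subst.
  by have e : U = V by apply: (KP_extensionality K); split; auto.
subst; have [d [db [c' [c'd [V' [V'd [cert spl]]]]]]] := Hb y yx.
have dB w : E w d -> E w B by move=> ?; apply/HB; exists d.
apply: splits_mono spl => w.
  move=> wc'; apply: c0c; apply/Hc0; exists c'; split=> //; apply/HC.
  by split=> //; apply: dB.
by move=> ?; apply/HV; right; apply/HV0; exists V'; split=> //; apply: dB.
Qed.

(** * Names and nodes *)

Lemma empty_inj a b : empty a -> empty b -> a = b.
Proof.
by move=> a0 b0; apply: (KP_extensionality K) => x; split=> [/a0|/b0].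
Qed.

Lemma adjoin_inj c c' a b : adjoin c a b -> adjoin c' a b -> c = c'.
Proof.
move=> [ac [bc Hc]] [ac' [bc' Hc']]; apply: (KP_extensionality K) => x.
by split=> [/Hc|/Hc'] [|->]; auto.
Qed.

Lemma adjC s t : adj s t <-> adj t s.
Proof. by rewrite /adj; intuition. Qed.

(* A node lies outside its own stage [W] since [adj] is reflexive, and its name
   is its only element that contains the empty set. *)
Lemma node_mem a W s b X t :
  node a W s -> node b X t -> has_empty s -> has_empty t ->
  sub W X -> E a X ->
  (E a b <-> adj s t) /\ ~ E b a /\ a <> b.
Proof.
have node_tag u Y r : node u Y r -> has_empty r ->
    (has_empty u -> False) /\ forall v, E v u -> has_empty v -> v = r.
  move=> [_ [_ Hu]] r0; split=> [[o [ou o0]]|v /Hu[[_ [nv _]]//|//]].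
  case: (Hu o ou) => [[_ [_ [v [/o0//]]]]|e].
  by subst; case: r0 => w [/o0].
move=> na nb s0 t0 WX aX.
have [a0 aE] := node_tag _ _ _ na s0; have [b0 bE] := node_tag _ _ _ nb t0.
have [sa [_ Ha]] := na; have [tb [Xb Hb]] := nb.
have bX : ~ E b X.
  move=> bX; apply: (@mem_irr b); apply: Xb => //.
  by split=> //; exists t; split=> //; split=> //; right; right.
split; last first.
  split; last by move=> e; subst.
  by move=> /Ha[[/WX//]|e]; subst.
split=> [/Hb[[_ [_ [u [ua [u0]]]]]|e]|st].
- by rewrite (aE u ua u0).
- by subst.
- by apply: Xb => //; split=> //; exists s.
Qed.

(** The induction is external, so only truly finite constructions count, whatever [M] considers
    finite. *)
Inductive hf : M -> Prop :=
| hf_empty a : empty a -> hf a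
| hf_adjoin a b c : hf a -> hf b -> adjoin c a b -> hf c.

Lemma hf_set (l : seq M) :
  (forall x, List.In x l -> hf x) ->
  exists2 a, hf a & forall x, E x a <-> List.In x l.
Proof.
elim: l => [_|u l IH Hl].
  have [o o0] := KP_empty K.
  by exists o => [|x]; [exact: hf_empty|split=> // /o0].
have [|a hfa Ha] := IH; first by move=> x ?; apply: Hl; right.
have [c adjc] := adjoin_ex a u; exists c.
  by apply: hf_adjoin adjc => //; apply: Hl; left.
have [ac [uc Hc]] := adjc.
by move=> x; split=> [/Hc[/Ha|->]|[<-|/Ha]]; [right|left| |auto].
Qed.

(* The set [t] of all previous names, put into the new name, rules out by
   foundation that the new name equals or belongs to a previous one. *)
Lemma name_ex (l : seq M) (P : M -> Prop) :
  (forall u, List.In u l -> hf u /\ has_empty u) ->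
  exists s, [/\ hf s, has_empty s &
    forall u, List.In u l -> u <> s /\ (adj u s <-> P u)].
Proof.
move=> Hl; have [t hft Ht] := hf_set (fun u lu => (Hl u lu).1).
have [o o0] := KP_empty K.
have [|s hfs Hs] := @hf_set [:: o, t & List.filter (fun u => `[< P u >]) l].
  move=> x /= [<-|[<-//|/List.filter_In[/Hl[]//]]]; exact: hf_empty.
have os : E o s by apply/Hs; left.
have ts : E t s by apply/Hs; right; left.
exists s; split=> // [|u lu]; first by exists o.
have ut : E u t by apply/Ht.
have us : u <> s by move=> e; subst; exact: (mem_asym ts ut).
(* An unintended adjacency would make [u] empty, equal to [t], or part of a membership cycle [s],
   [u], [t]. *)
split=> //; split=> [[/Hs /= [e|[e|/List.filter_In[_ /asboolP//]]]|[su|//]]|Pu].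
- by case: (Hl u lu) => _ [w [+ _]]; subst => /o0.
- by subst; case: (@mem_irr u).
- by case: (mem_acyc3 ts su ut).
- left; apply/Hs; right; right; apply/List.filter_In; split=> //.
  exact/asboolP.
Qed.

(** * Gaps of ill-founded rank *)

Section Chains.
Variable c : M.
Hypothesis cert : certificate c.

(** Accessibility is judged outside [M], so it is kept apart from the internal certificate. Taking
    [V'] below [V] matches the slack in [splits]. *)
Definition gap (U V : M) : Prop :=
  exists x V', [/\ ~ Acc E x, interval c x U V' & sub V' V].

Lemma gap_sub U V : gap U V -> sub U V.
Proof. by move=> [x [V' [_ [z [p [_ [_ [_ ?]]]]] ?]]] w; auto. Qed.

Lemma gap_split U V :
  gap U V -> exists W W', [/\ gap U W, step W W' & gap W' V].
Proof.
move=> [x [V' [nacc int V'V]]].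
have [y [yx nacc_y]] : exists y, E y x /\ ~ Acc E y.
  apply: contrapT => H; apply: nacc; constructor=> y yx.
  by apply: contrapT => ?; apply: H; exists y.
have [W [W' [V0 [int1 [st [int2 V0V']]]]]] := cert int yx.
exists W, W'; split=> //; first by exists y, W; split=> // w.
by exists y, V0; split=> // w; auto.
Qed.

(** One split pays for each [adjoin]: by induction both arguments lie in [W], and the step to [W']
    adjoins them. *)
Lemma hf_gap a U V : hf a -> has_empty U -> gap U V -> E a V.
Proof.
move=> hfa [o [oU o0]]; elim: hfa U V oU => {}a.
  by move=> a0 U V oU /gap_sub; rewrite (empty_inj a0 o0); apply.
move=> b d _ IHa _ IHb adjd U V oU /gap_split[W [W' [gW [_ [_ st]] gV]]].
have [d' [d'W' adjd']] := st a (IHa _ _ oU gW) b (IHb _ _ oU gW).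
by rewrite (adjoin_inj adjd adjd'); apply: (gap_sub gV).
Qed.

(** * Chains of nodes and finite partial embeddings *)

Section Graph.
Variables (G : Type) (R : G -> G -> Prop).

Record entry := Entry { point : G; name : M; image : M }.

Fixpoint chain (U : M) (l : seq entry) (V : M) : Prop :=
  if l is p :: l' then
    exists W W', gap U W /\ step W W' /\ node (image p) W (name p) /\
      E (image p) W' /\ chain W' l' V
  else gap U V.

(** The gap at the place of insertion is split, and the new node is formed on the stage in between.
    As stages increase, having [s] in [U] puts it on whichever stage this is. *)
Lemma chain_insert g s l1 l2 U V :
  E s U -> chain U (l1 ++ l2) V ->
  exists a, chain U (l1 ++ Entry g s a :: l2) V.
Proof.
have insert_gap U0 W : E s U0 -> gap U0 W -> exists a W0 W0',
    [/\ gap U0 W0, step W0 W0', node a W0 s, E a W0' & gap W0' W].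
  move=> sU /gap_split[W0 [W0' [g0 st g1]]].
  have [a [aW0' na]] := st.2.1 s (gap_sub g0 sU).
  by exists a, W0, W0'.
elim: l1 U => [|p l1 IH] U sU /=.
  case: l2 => [|q l2] /= H.
    have [a [W [W' [*]]]] := insert_gap _ _ sU H.
    by exists a, W, W'.
  case: H => W1 [W1' [/(insert_gap _ _ sU)[a [W [W' [? ? ? ? ?]]]] ?]].
  by exists a, W, W'; do 4 split=> //; exists W1, W1'.
move=> [W [W' [gW [st [np [pW' ch]]]]]].
have [|a ?] := IH W' _ ch; first exact: (st.1 _ (gap_sub gW sU)).
by exists a, W, W'.
Qed.

Lemma chain_node U l V p :
  chain U l V -> List.In p l ->
  exists W, sub U W /\ node (image p) W (name p).
Proof.
elim: l U => // q l IH U [W [W' [gW [st [nq [_ ch]]]]]] [<-|pl].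
  by exists W; split=> //; exact: gap_sub.
have [W1 [W'W1 np]] := IH W' ch pl; exists W1; split=> // w wU.
by apply/W'W1/st.1/(gap_sub gW).
Qed.

Lemma chain_mem U l V :
  chain U l V -> (forall p, List.In p l -> has_empty (name p)) ->
  all_pairs (fun p q =>
    (E (image p) (image q) <-> adj (name p) (name q)) /\
    ~ E (image q) (image p) /\ image p <> image q) l.
Proof.
elim: l U => // p l IH U [W [W' [gW [st [np [pW' ch]]]]]] l0; split.
  move=> q ql.
  have [X [W'X nq]] := chain_node ch ql.
  apply: (node_mem np nq); [| | |exact: W'X].
  - by apply: l0; left.
  - by apply: l0; right.
  - by move=> w ?; apply/W'X/st.1.
by apply: (IH W') => // q ql; apply: l0; right.
Qed.

Hypothesis acyc : acyclic R.
Variables U V : M.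
Hypothesis UV : gap U V.
Hypothesis hfU : forall s, hf s -> E s U.

(** Paths may run through points not yet listed, hence the closure in all of [G]: later insertions
    must not meet a conflicting order. *)
Definition before (p q : entry) : Prop :=
  ~ clos_trans G R (point q) (point p) /\ point p <> point q.

(** Symmetric and reflexive like [adj]: names carry no direction, which is recovered from the order
    of the list. *)
Definition adjacent (g h : G) : Prop := R g h \/ R h g \/ g = h.

Definition valid (l : seq entry) : Prop :=
  [/\ chain U l V,
      forall p, List.In p l -> hf (name p) /\ has_empty (name p),
      forall p q, List.In p l -> List.In q l ->
        name p = name q -> point p = point q,
      forall p q, List.In p l -> List.In q l ->
        (adj (name p) (name q) <-> adjacent (point p) (point q)) &
      all_pairs before l].

(** The cut comes just behind the last point with a path to [g]. A path from [g] to a point at or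
    before it would compose to a backward path or a cycle. *)
Lemma cut_ex g (l : seq entry) :
  all_pairs before l ->
  exists l1 l2, [/\ l = l1 ++ l2,
    forall q, List.In q l1 -> ~ clos_trans G R g (point q) &
    forall q, List.In q l2 -> ~ clos_trans G R (point q) g].
Proof.
elim: l => [_|h l IH [hl ordl]].
  by exists [::], [::].
have [l1 [l2 [El Hl1 Hl2]]] := IH ordl.
have [[q [ql qg]]|H] :=
    pselect (exists q, List.In q (h :: l) /\ clos_trans G R (point q) g).
  exists (h :: l1), l2; split=> [|r [<- gh|/Hl1]|] //; first by rewrite El.
  have qh := t_trans _ _ _ _ _ qg gh.
  by case: ql => [e|/hl[/(_ qh)//]]; subst; exact: (acyc qh).
by exists [::], (h :: l); split=> // q ql qg; apply: H; exists q.
Qed.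

Lemma valid_extend g l : valid l ->
  exists l', [/\ valid l', forall p, List.In p l -> List.In p l' &
    exists p, List.In p l' /\ point p = g].
Proof.
move=> vl; have [chl hfl injl adjl ordl] := vl.
have [[p ?]|new] := pselect (exists p, List.In p l /\ point p = g).
  by exists l; split=> //; exists p.
(* The pattern is prescribed on names; by [injl] a name determines its point, so this is
   unambiguous. *)
have [|s [hfs s0 Hs]] := @name_ex (List.map name l) (fun u =>
    exists p, [/\ List.In p l, name p = u & adjacent (point p) g]).
  by move=> u /List.in_map_iff[p [<- /hfl]].
have [l1 [l2 [El Hl1 Hl2]]] := cut_ex g ordl.
have [|a cha] := @chain_insert g s l1 l2 U V (hfU hfs); first by rewrite -El.
pose p0 := Entry g s a; exists (l1 ++ p0 :: l2).
have in_l p : List.In p (l1 ++ p0 :: l2) -> p = p0 \/ List.In p l.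
  by rewrite El => /in_insert.
have newl p : List.In p l -> point p <> g by move=> pl e; apply: new; exists p.
have Hsl p : List.In p l ->
    name p <> s /\ (adj (name p) s <-> adjacent (point p) g).
  move=> pl; have [ps Hp] := Hs (name p) (List.in_map _ _ _ pl); split=> //.
  rewrite Hp; split=> [[q [ql qp H]]|H]; last by exists p.
  by rewrite -(injl _ _ ql pl qp).
have adjacentC x y : adjacent x y <-> adjacent y x.
  by rewrite /adjacent; intuition.
have adj_refl x : adj x x by right; right.
have adjacent_refl x : adjacent x x by right; right.
split; last by exists p0; split=> //; by apply/in_insert; left.
  split=> //.
  - by move=> p /in_l[->|/hfl].
  - move=> p q /in_l[->|pl] /in_l[->|ql] //=; last exact: injl.
      by move=> /esym; case: (Hsl q ql).
    by case: (Hsl p pl).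
  - move=> p q /in_l[->|pl] /in_l[->|ql] //=; last exact: adjl.
      by rewrite adjC adjacentC; case: (Hsl q ql).
    by case: (Hsl p pl).
  - apply: all_pairs_insert; first by rewrite -El.
      move=> q ql; split; first exact: Hl1.
      by apply: newl; rewrite El; apply/in_cat; left.
    move=> q ql; split; first exact: Hl2.
    by apply/nesym/newl; rewrite El; apply/in_cat; right.
by move=> p; rewrite El !in_cat /=; intuition.
Qed.

Lemma valid_embeds l p q : valid l -> List.In p l -> List.In q l ->
  (R (point p) (point q) <-> E (image p) (image q)) /\
  (image p = image q -> point p = point q).
Proof.
move=> [chl hfl _ adjl ordl].
(* The order excludes equality and the edge from [t] to [r], so adjacency can only mean the edge
   from [r] to [t]. *)
have before_mem r t : List.In r l -> List.In t l ->
    before r t -> (E (image r) (image t) <-> adj (name r) (name t)) ->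
    R (point r) (point t) <-> E (image r) (image t).
  move=> rl tl [ntr rt] ->; rewrite adjl // /adjacent; split; first by left.
  by case=> // -[tr|//]; case: ntr; exact: t_step.
have ordl' : all_pairs (fun r t => before r t /\
    (E (image r) (image t) <-> adj (name r) (name t)) /\
    ~ E (image t) (image r) /\ image r <> image t) l.
  have := chain_mem chl (fun p pl => (hfl p pl).2).
  elim: (l) ordl => //= r l' IH [H1 H2] [H3 H4]; split; last exact: IH.
  by move=> t tl; split; [apply: H1|apply: H3].
move=> pl ql; have [->|[[b [mem [nmem ne]]]|[b [mem [nmem ne]]]]] :=
  all_pairs_in ordl' pl ql.
- split=> //; split=> [Rqq|/mem_irr//].
  by case: (acyc (t_step _ _ _ _ Rqq)).
- by split; [exact: before_mem|move=> /ne].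
- split; last by move=> /esym/ne.
  by split=> [Rpq|/nmem//]; case: b.1; exact: t_step.
Qed.

Lemma embedding_ex (phi : G -> nat) : injective phi ->
  exists f : G -> M, injective f /\ forall g h, R g h <-> E (f g) (f h).
Proof.
move=> phi_inj.
(* Validity is a premise under the existential, so that choice yields an extension function on all
   lists. *)
have extend_ex (nl : nat * seq entry) : exists l', valid nl.2 ->
    [/\ valid l', forall p, List.In p nl.2 -> List.In p l' &
      forall g, phi g = nl.1 -> exists p, List.In p l' /\ point p = g].
  case: nl => n l /=.
  have [vl|nvl] := pselect (valid l); last by exists l.
  have [[g <-]|nog] := pselect (exists g, phi g = n).
    have [l' [vl' ll' gl']] := valid_extend g vl.
    by exists l' => _; split=> // h /phi_inj->.
  by exists l => _; split=> // g e; case: nog; exists g.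
have [F HF] := choice extend_ex.
pose stage := fix stage n := if n is m.+1 then F (m, stage m) else [::].
have valid_stage n : valid (stage n).
  by elim: n => [|n IH] //=; case: (HF (n, stage n) IH).
have stage_mono m n : (m <= n)%N ->
    forall p, List.In p (stage m) -> List.In p (stage n).
  move=> /subnK<-; elim: (n - m)%N => // k IH p /IH.
  by rewrite addSn; case: (HF (k + m, stage (k + m))%N) => //= _ H _ /H.
have point_stage g : exists p, List.In p (stage (phi g).+1) /\ point p = g.
  by case: (HF (phi g, stage (phi g)) (valid_stage _)) => _ _; apply.
have [e He] := choice point_stage.
have in_stage g h : List.In (e g) (stage (phi g + phi h).+1) /\
    List.In (e h) (stage (phi g + phi h).+1).
  by split; [case: (He g) => + _|case: (He h) => + _]; apply: stage_mono;
    rewrite ltnS ?leq_addr ?leq_addl.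
have He2 g h := valid_embeds (valid_stage _) (in_stage g h).1 (in_stage g h).2.
exists (fun g => image (e g)); split=> g h; have [R_E im_inj] := He2 g h.
  by move=> /im_inj; rewrite (He g).2 (He h).2.
by rewrite -R_E (He g).2 (He h).2.
Qed.

End Graph.
End Chains.

(** * From ill-foundedness to the embedding of a countable graph *)

Lemma countable_acyclic_embedding (G : Type) (R : G -> G -> Prop)
    (phi : G -> nat) :
  ill_founded E -> acyclic R -> injective phi ->
  exists f : G -> M, injective f /\ forall g h, R g h <-> E (f g) (f h).
Proof.
move=> ill acyc phi_inj.
have [x nacc] : exists x, ~ Acc E x.
  apply: contrapT => H; apply: ill => x.
  by apply: contrapT => ?; apply: H; exists x.
have [o o0] := KP_empty K; have [U [_ [oU _]]] := adjoin_ex o o.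
have [V [c [cert int]]] := interval_ex x U.
have gUV : gap c U V by exists x, V; split=> // w.
(* The left half is spent on collecting all hereditarily finite sets into [W']; the chains live in
   the right half. *)
have [W [W' [gW st gV]]] := gap_split cert gUV.
apply: (@embedding_ex c cert G R acyc W' V gV _ phi phi_inj) => s hfs.
by apply: st.1; apply: (hf_gap cert hfs _ gW); exists o.
Qed.

End Model.
End KripkePlatek.

Theorem corollary29 :
  forall (M : Type) (E : M -> M -> Prop),
    countable (@setT M) -> KP E -> ill_founded E ->
  forall (G : Type) (R : G -> G -> Prop),
    countable (@setT G) -> acyclic R ->
  exists N : set M, isomorphic R (@submodel M E N).
Proof.
move=> M E _ K ill G R /countable_injP[phi phi_inj] acyc.
have [|f [f_inj R_E]] := countable_acyclic_embedding K ill acyc (phi := phi).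
  by move=> g h; apply: phi_inj; rewrite in_setT.
pose f' g : range f := SigSub (mem_set (imageT f g)).
exists (range f), f'; split=> //.
have preim (y : range f) : exists g, f g = val y.
  by case: (set_mem (valP y)) => g _ <-; exists g.
have [k Hk] := choice preim.
exists k => [g|y]; first by apply: f_inj; rewrite Hk.
by apply: val_inj; rewrite /= Hk.
Qed.
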